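(* Let $A\in\mathcal{V}$ be an algebra such that $K(A)$ is closed under the commutator operation and that fulfills $(\star)$. Then the following are equivalent: (1) $A$ is an $mp$-algebra; (2) for all distinct $\phi,\psi\in Min(A)$ we have $O(\phi)\vee O(\psi)=\nabla_A$.
   Context: $\mathcal{V}$ is a fixed congruence-modular variety of algebras (of a finite signature) that is semidegenerate: no nontrivial algebra in $\mathcal{V}$ has one-element subalgebras (equivalently, $\nabla_A$ is compact in $Con(A)$ for every $A\in\mathcal{V}$). For $A\in\mathcal{V}$, $Con(A)$ is the complete lattice of congruences of $A$, with least element $\Delta_A$ and greatest element $\nabla_A$; $K(A)$ is the set of compact (= finitely generated) congruences. Commutator: $[\cdot,\cdot]=[\cdot,\cdot]_A$ is the (modular) commutator, i.e. the greatest operation on the congruence lattices of members of $\mathcal{V}$ such that for every surjective morphism $f:A\to B$ in $\mathcal{V}$ and all $\alpha,\beta\in Con(A)$: $[\alpha,\beta]_A\subseteq\alpha\cap\beta$ and $[\alpha,\beta]_A\vee Ker(f)=f^{-1}([f(\alpha\vee Ker(f)),f(\beta\vee Ker(f))]_B)$. Iterates: $[\alpha,\alpha]^0=\alpha$, $[\alpha,\beta]^1=[\alpha,\beta]$, $[\alpha,\beta]^{n+1}=[[\alpha,\beta]^n,[\alpha,\beta]^n]$. Condition $(\star)$: for all $\alpha,\beta\in K(A)$ and every integer $n\geq 1$ there is an integer $m\geq 0$ with $[[\alpha,\alpha]^m,[\beta,\beta]^m]\subseteq[\alpha,\beta]^n$. $\phi\in Con(A)\setminus\{\nabla_A\}$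 is prime if $[\alpha,\beta]\subseteq\phi$ implies $\alpha\subseteq\phi$ or $\beta\subseteq\phi$ (for $\alpha,\beta\in Con(A)$); $Spec(A)$ is the set of prime congruences and $Min(A)$ the set of minimal prime congruences. $A$ is an $mp$-algebra if every prime congruence of $A$ contains a unique minimal prime congruence. For $\theta\in Con(A)$, $O(\theta)=\bigvee\{\alpha\in Con(A)\mid[\alpha,\beta]=\Delta_A\text{ for some congruence }\beta\not\subseteq\theta\}$. *)

(* Defs.v *)
From mathcomp Require Import all_boot.
From mathcomp Require Import boolp classical_sets functions cardinality.

Set Implicit Arguments.
Unset Strict Implicit.
Unset Printing Implicit Defensive.

Local Open Scope classical_set_scope.

#[local] Obligation Tactic := idtac.

(** * Algebras of a finite signature *)

Record signature := Signature { sym : finType; arity : sym -> nat }.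

Record algebra (S : signature) := Algebra {
  carrier :> Type;
  op : forall o : sym S, ('I_(arity o) -> carrier) -> carrier;
  carrier_nonempty : inhabited carrier }.

Record hom (S : signature) (A B : algebra S) := Hom {
  hom_fun :> A -> B;
  homP : forall (o : sym S) (a : 'I_(arity o) -> A),
    hom_fun (op a) = op (fun i => hom_fun (a i)) }.

Definition surjective (T U : Type) (f : T -> U) : Prop :=
  forall y, exists x, f x = y.

Definition subuniverse (S : signature) (A : algebra S) (X : set A) : Prop :=
  forall (o : sym S) (a : 'I_(arity o) -> A), (forall i, X (a i)) -> X (op a).

Definition trivial_algebra (S : signature) (A : algebra S) : Prop :=
  forall x y : A, x = y.

(** * Varieties *)

Inductive term (S : signature) : Type :=
| Var of nat
| App (o : sym S) of ('I_(arity o) -> term S).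

Fixpoint eval (S : signature) (A : algebra S) (v : nat -> A) (t : term S) : A :=
  match t with
  | Var n => v n
  | App o ts => op (fun i => eval v (ts i))
  end.

(* A variety is given by a set of identities; its members are the models. *)
Definition variety (S : signature) := set (term S * term S).

Definition in_variety (S : signature) (V : variety S) (A : algebra S) : Prop :=
  forall s t, V (s, t) -> forall v : nat -> A, eval v s = eval v t.

(** * Congruences *)

Record con (S : signature) (A : algebra S) := Con {
  con_rel :> A -> A -> Prop;
  con_refl : forall x, con_rel x x;
  con_sym : forall x y, con_rel x y -> con_rel y x;
  con_trans : forall x y z, con_rel x y -> con_rel y z -> con_rel x z;
  con_op : forall (o : sym S) (a b : 'I_(arity o) -> A),
    (forall i, con_rel (a i) (b i)) -> con_rel (op a) (op b) }.

Declare Scope con_scope.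
Delimit Scope con_scope with con.

Definition con_le (S : signature) (A : algebra S) (alpha beta : con A) : Prop :=
  forall x y, alpha x y -> beta x y.

Notation "a <=c b" := (con_le a b) (at level 70, no associativity) : con_scope.
Local Open Scope con_scope.

Lemma con_le_anti (S : signature) (A : algebra S) (alpha beta : con A) :
  alpha <=c beta -> beta <=c alpha -> alpha = beta.
Proof.
case: alpha => r1 a1 b1 c1 d1; case: beta => r2 a2 b2 c2 d2 /= h12 h21.
have e : r1 = r2.
  by apply/funext => x; apply/funext => y; apply/propext; split;
    [exact: h12|exact: h21].
subst r2; congr Con; exact: Prop_irrelevance.
Qed.

Section ConLattice.
Variables (S : signature) (A : algebra S).
Implicit Types alpha beta theta : con A.

(* Delta_A *)
Program Definition cbot : con A := @Con S A (fun x y => x = y) _ _ _ _.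
Next Obligation. by []. Qed.
Next Obligation. by move=> x y ->. Qed.
Next Obligation. by move=> x y z -> ->. Qed.
Next Obligation. by move=> o a b h; congr op; apply/funext. Qed.

(* nabla_A *)
Program Definition ctop : con A := @Con S A (fun _ _ => True) _ _ _ _.
Solve All Obligations with by [].

Program Definition cmeet alpha beta : con A :=
  @Con S A (fun x y => alpha x y /\ beta x y) _ _ _ _.
Next Obligation. by move=> alpha beta x; split; apply: con_refl. Qed.
Next Obligation. by move=> alpha beta x y [? ?]; split; apply: con_sym. Qed.
Next Obligation.
move=> alpha beta x y z [h1 h2] [h3 h4].
by split; [apply: con_trans h1 h3|apply: con_trans h2 h4].
Qed.
Next Obligation.
by move=> alpha beta o a b h; split; apply: con_op => i; case: (h i).
Qed.

(* The congruence generated by a binary relation. *)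
Program Definition cgen (R : A -> A -> Prop) : con A :=
  @Con S A
    (fun x y => forall theta, (forall u v, R u v -> theta u v) -> theta x y)
    _ _ _ _.
Next Obligation. by move=> R x theta _; apply: con_refl. Qed.
Next Obligation. by move=> R x y h theta /h; apply: con_sym. Qed.
Next Obligation.
by move=> R x y z h1 h2 theta hR; apply: con_trans (h1 _ hR) (h2 _ hR).
Qed.
Next Obligation. by move=> R o a b h theta hR; apply: con_op => i; apply: h. Qed.

Definition csup (F : set (con A)) : con A :=
  cgen (fun x y => exists2 alpha, F alpha & alpha x y).

Definition cjoin alpha beta : con A := csup [set alpha; beta].

Lemma csup_ub (F : set (con A)) alpha : F alpha -> alpha <=c csup F.
Proof. by move=> Fa x y axy theta h; apply: h; exists alpha. Qed.

Lemma csup_le (F : set (con A)) theta :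
  (forall alpha, F alpha -> alpha <=c theta) -> csup F <=c theta.
Proof. by move=> h x y; apply => u v [alpha Fa]; apply: h. Qed.

Definition compact_con alpha : Prop :=
  forall F : set (con A), alpha <=c csup F ->
    exists G : set (con A), [/\ finite_set G, G `<=` F & alpha <=c csup G].

End ConLattice.

Arguments cbot {S} A.
Arguments ctop {S} A.

Notation "a /\c b" := (cmeet a b) (at level 40, left associativity) : con_scope.
Notation "a \/c b" := (cjoin a b) (at level 50, left associativity) : con_scope.

Program Definition con_preim (S : signature) (A B : algebra S) (f : hom A B)
    (gamma : con B) : con A :=
  @Con S A (fun x y => gamma (f x) (f y)) _ _ _ _.
Next Obligation. by move=> S A B f gamma x; apply: con_refl. Qed.
Next Obligation. by move=> S A B f gamma x y; apply: con_sym. Qed.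
Next Obligation. by move=> S A B f gamma x y z; apply: con_trans. Qed.
Next Obligation.
by move=> S A B f gamma o a b h; rewrite /= !homP; apply: con_op.
Qed.

Definition con_ker (S : signature) (A B : algebra S) (f : hom A B) : con A :=
  con_preim f (cbot B).

(* The direct image {(f a, f b) | (a, b) in theta} need not be a congruence in
   general, hence the generated one is taken; when f is surjective and theta
   contains the kernel, which is the only case used, nothing is added: see
   con_imgE. *)
Definition con_img (S : signature) (A B : algebra S) (f : hom A B)
    (theta : con A) : con B :=
  cgen (fun x y => exists a b, [/\ theta a b, f a = x & f b = y]).

Lemma con_imgE (S : signature) (A B : algebra S) (f : hom A B) (theta : con A) :
  surjective f -> con_ker f <=c theta ->
  forall x y, con_img f theta x y <->
    exists a b, [/\ theta a b, f a = x & f b = y].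
Proof.
move=> fs kt x y; split; last by move=> h th; apply.
pose R u v := exists a b, [/\ theta a b, f a = u & f b = v].
have R1 u : R u u by have [a <-] := fs u; exists a, a; split=> //; apply: con_refl.
have R2 u v : R u v -> R v u.
  by move=> [a [b [h <- <-]]]; exists b, a; split=> //; apply: con_sym.
have R3 u v w : R u v -> R v w -> R u w.
  move=> [a [b [h <- <-]]] [c [d [h' e <-]]]; exists a, d; split=> //.
  apply: con_trans h _; apply: con_trans h'; apply: kt; exact: esym.
have R4 (o : sym S) (u v : 'I_(arity o) -> B) :
    (forall i, R (u i) (v i)) -> R (op u) (op v).
  move=> h; have [p hp] := choice h; have [q hq] := choice hp.
  exists (op p), (op q); rewrite !homP; split.
  - by apply: con_op => i; case: (hq i).
  - by congr op; apply/funext => i; case: (hq i).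
  - by congr op; apply/funext => i; case: (hq i).
by move=> /(_ (Con R1 R2 R3 R4)); apply.
Qed.

(** * Modularity and semidegeneracy *)

Definition congruence_modular (S : signature) (V : variety S) : Prop :=
  forall A : algebra S, in_variety V A -> forall alpha beta gamma : con A,
    alpha <=c gamma ->
    alpha \/c (beta /\c gamma) = (alpha \/c beta) /\c gamma.

Definition semidegenerate (S : signature) (V : variety S) : Prop :=
  forall A : algebra S, in_variety V A -> ~ trivial_algebra A ->
    ~ exists x : A, subuniverse [set x].

(** * The modular commutator *)

(* Operations are total on algebras of the signature; only their values on
   members of V are constrained or compared. *)
Definition con_operation (S : signature) :=
  forall A : algebra S, con A -> con A -> con A.

Definition commutator_like (S : signature) (V : variety S)
    (C : con_operation S) : Prop :=
  forall (A B : algebra S) (f : hom A B),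
    in_variety V A -> in_variety V B -> surjective f ->
    forall alpha beta : con A,
      C A alpha beta <=c alpha /\c beta /\
      C A alpha beta \/c con_ker f =
        con_preim f (C B (con_img f (alpha \/c con_ker f))
                         (con_img f (beta \/c con_ker f))).

Definition is_commutator (S : signature) (V : variety S)
    (C : con_operation S) : Prop :=
  commutator_like V C /\
  forall D : con_operation S, commutator_like V D ->
    forall A : algebra S, in_variety V A -> forall alpha beta : con A,
      D A alpha beta <=c C A alpha beta.

(* The greatest such operation always exists, as a pointwise supremum. *)
Lemma commutator_exists (S : signature) (V : variety S) :
  exists C : con_operation S, is_commutator V C.
Proof.
pose P A (al be : con A) :=
  [set D A al be | D in [set D : con_operation S | commutator_like V D]].
exists (fun A al be => csup (P A al be)); split; last first.
  by move=> D HD A _ al be; apply: csup_ub; exists D.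
move=> A B f VA VB fs al be; split.
  by apply: csup_le => _ [D HD <-]; have [] := HD A B f VA VB fs al be.
set al' := con_img f _; set be' := con_img f _.
have HD D : commutator_like V D ->
    D A al be \/c con_ker f = con_preim f (D B al' be').
  by move=> HD; have [] := HD A B f VA VB fs al be.
apply: con_le_anti.
  apply: csup_le => _ [->|->].
    apply: csup_le => _ [D DP <-] x y Dxy.
    apply: (csup_ub (F := P B al' be')); first by exists D.
    suff: con_preim f (D B al' be') x y by [].
    by rewrite -HD //; apply: csup_ub Dxy; left.
  by move=> x y /= e u; rewrite /= e => _; apply: con_refl.
set th := _ \/c _.
have kt : con_ker f <=c th by apply: csup_ub; right.
have le : csup (P B al' be') <=c con_img f th.
  apply: csup_le => _ [D DP <-] u v Duv; apply/con_imgE => //.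
  have [a ea] := fs u; have [b eb] := fs v; exists a, b; split=> //.
  have : con_preim f (D B al' be') a b by rewrite /= ea eb.
  rewrite -HD //; apply: csup_le => _ [->|->] //.
  move=> x y Dxy; apply: (csup_ub (F := [set csup (P A al be); con_ker f])).
    by left.
  by apply: csup_ub Dxy; exists D.
move=> x y /= /le /con_imgE [//|//|a [b [tab ea eb]]].
apply: con_trans (con_trans (kt _ _ _) tab) (kt _ _ _); first exact: esym.
exact: eb.
Qed.

(** * Notions relative to a commutator on Con(A) *)

Section Spectrum.
Variables (S : signature) (A : algebra S) (c : con A -> con A -> con A).
Implicit Types alpha beta theta phi psi : con A.

(* comm_iter alpha beta n is [alpha, beta]^n; for n = 0 this is meaningful only
   when beta = alpha. *)
Definition comm_iter alpha beta (n : nat) : con A :=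
  if n is n'.+1 then iter n' (fun gamma => c gamma gamma) (c alpha beta)
  else alpha.

Definition compact_closed : Prop :=
  forall alpha beta,
    compact_con alpha -> compact_con beta -> compact_con (c alpha beta).

Definition star_condition : Prop :=
  forall alpha beta, compact_con alpha -> compact_con beta ->
  forall n : nat, 0 < n -> exists m : nat,
    c (comm_iter alpha alpha m) (comm_iter beta beta m)
      <=c comm_iter alpha beta n.

Definition prime_con phi : Prop :=
  phi <> ctop A /\
  forall alpha beta, c alpha beta <=c phi -> alpha <=c phi \/ beta <=c phi.

Definition min_prime phi : Prop :=
  prime_con phi /\ forall psi, prime_con psi -> psi <=c phi -> psi = phi.

Definition mp_algebra : Prop :=
  forall phi, prime_con phi -> exists! psi, min_prime psi /\ psi <=c phi.

Definition O_con theta : con A :=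
  csup [set alpha | exists beta, ~ beta <=c theta /\ c alpha beta = cbot A].

End Spectrum.

(* Main.v *)
Require Import Defs.
From mathcomp Require Import all_boot.
From mathcomp Require Import boolp classical_sets cardinality.

Set Implicit Arguments.
Unset Strict Implicit.
Unset Printing Implicit Defensive.

Local Open Scope classical_set_scope.
Local Open Scope con_scope.

#[local] Obligation Tactic := idtac.

(** The lattice-theoretic half of the argument imitates commutative rings, with
    prime congruences for prime ideals and O(phi) for the kernel of the
    localisation at phi. A prime contains O of each minimal prime below it
    ([O_con_le]), so (2) forbids two minimal primes below the same prime.
    Conversely, if O(phi) and O(psi) do not join to the top, some prime mu
    contains both; a minimal prime is below every prime that contains its O
    ([min_prime_le_O]), hence phi and psi are both below mu and agree by (1).

    Two facts carry this. [prime_separation] enlarges a congruence avoiding an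
    m-system of compact congruences to a prime one. Applied to the singleton
    of the top congruence it yields mu, which requires the top to be compact
    and equal to its own commutator. Applied to the commutators of the
    n-th iterates of alpha and beta, for beta compact and not below phi, it
    shows that some iterate of a compact alpha below a minimal prime phi is
    annihilated by a congruence not below phi ([min_prime_annihilator]); the
    star condition is what makes these commutators an m-system.

    The commutator enters only through monotonicity, the inequality
    [comm_join], and the value at the top. It is known only as the greatest
    operation compatible with surjections, so each property is obtained by
    exhibiting an operation of that kind. For monotonicity this is the monotone
    hull of the commutator. For the top it is the Hagemann-Herrmann commutator
    [hcomm], read off the congruence Delta on alpha, viewed as a subalgebra of
    the square, that identifies diagonal pairs along beta. That [hcomm] is
    compatible with surjections is where modularity is really used: directly in
    [Delta_collapse], and through a shifting argument in the symmetry
    [hcomm_sym_le], which transports compatibility from one argument to the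
    other. Semidegeneracy makes [hcomm] of the top with itself the top, because
    the diagonal would otherwise be a one-element subalgebra of a nontrivial
    quotient of the square. *)

(** * The lattice of congruences *)

Section Lattice.
Variables (S : signature) (A : algebra S).
Implicit Types alpha beta gamma delta theta : con A.

Lemma cle_trans beta alpha gamma :
  alpha <=c beta -> beta <=c gamma -> alpha <=c gamma.
Proof. by move=> h1 h2 x y /h1 /h2. Qed.

Lemma cbot_le alpha : cbot A <=c alpha.
Proof. by move=> x y ->; apply: con_refl. Qed.

Lemma cjoinl alpha beta : alpha <=c alpha \/c beta.
Proof. by apply: csup_ub; left. Qed.

Lemma cjoinr alpha beta : beta <=c alpha \/c beta.
Proof. by apply: csup_ub; right. Qed.

Lemma cjoin_le alpha beta gamma :
  alpha <=c gamma -> beta <=c gamma -> alpha \/c beta <=c gamma.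
Proof. by move=> h1 h2; apply: csup_le => _ [->|->]. Qed.

Lemma cjoin_mono alpha beta alpha' beta' :
  alpha <=c alpha' -> beta <=c beta' -> alpha \/c beta <=c alpha' \/c beta'.
Proof.
move=> h1 h2; apply: cjoin_le.
- exact: cle_trans h1 (@cjoinl _ _).
- exact: cle_trans h2 (@cjoinr _ _).
Qed.

Lemma cjoin_idr alpha beta : beta <=c alpha -> alpha \/c beta = alpha.
Proof.
by move=> h; apply: con_le_anti; [apply: cjoin_le|apply: cjoinl].
Qed.

Lemma cjoinC alpha beta : alpha \/c beta = beta \/c alpha.
Proof. by congr csup; rewrite setUC. Qed.

Lemma csup_mono (F G : set (con A)) : F `<=` G -> csup F <=c csup G.
Proof. by move=> FG; apply: csup_le => alpha /FG; apply: csup_ub. Qed.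

Lemma cgen_le (R : A -> A -> Prop) theta :
  (forall x y, R x y -> theta x y) -> cgen R <=c theta.
Proof. by move=> h x y; apply. Qed.

Lemma cgen_in (R : A -> A -> Prop) x y : R x y -> cgen R x y.
Proof. by move=> h theta; apply. Qed.

Lemma not_top alpha : alpha <> ctop A -> exists x y, ~ alpha x y.
Proof.
move=> h; apply: contrapT => H; apply: h; apply: con_le_anti => // x y _.
by apply: contrapT => h; apply: H; exists x, y.
Qed.

Program Definition cinf (F : set (con A)) : con A :=
  @Con S A (fun x y => forall alpha, F alpha -> alpha x y) _ _ _ _.
Next Obligation. by move=> F x alpha _; apply: con_refl. Qed.
Next Obligation. by move=> F x y h alpha /h; apply: con_sym. Qed.
Next Obligation.
by move=> F x y z h1 h2 alpha Fa; apply: con_trans (h1 _ Fa) (h2 _ Fa).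
Qed.
Next Obligation. by move=> F o a b h alpha Fa; apply: con_op => i; apply: h. Qed.

(** Joins are finitary because the operations are: the pairs lying in a join
    of finitely many members of [F] already form a congruence, one finite
    subfamily per argument of an operation being united into a single one. *)
Lemma csup_finitary (F : set (con A)) x y : csup F x y ->
  exists G : set (con A), [/\ finite_set G, G `<=` F & csup G x y].
Proof.
pose R u v := exists G : set (con A),
  [/\ finite_set G, G `<=` F & csup G u v].
have R1 u : R u u by exists set0; split=> //; apply: con_refl.
have R2 u v : R u v -> R v u.
  by move=> [G [h1 h2 h3]]; exists G; split=> //; apply: con_sym.
have R3 u v w : R u v -> R v w -> R u w.
  move=> [G [h1 h2 h3]] [H [k1 k2 k3]]; exists (G `|` H); split.
  - by rewrite finite_setU.
  - by move=> al [/h2|/k2].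
  - apply: (con_trans (y := v)).
    + by apply: csup_mono h3; left.
    + by apply: csup_mono k3; right.
have R4 (o : sym S) (a b : 'I_(arity o) -> A) :
    (forall i, R (a i) (b i)) -> R (op a) (op b).
  move=> h; have [G hG] := choice h.
  exists (\bigcup_(i in [set: 'I_(arity o)]) G i); split.
  - by apply: bigcup_finite => [|i _]; [exact: finite_finset|case: (hG i)].
  - by move=> al [i _]; case: (hG i) => _ + _; apply.
  - apply: con_op => i; case: (hG i) => _ _; apply: csup_mono => al Gal.
    by exists i.
move=> /(_ (Con R1 R2 R3 R4)); apply => u v [al Fal aluv].
exists [set al]; split; first exact: finite_set1.
- by move=> _ ->.
- by apply: csup_ub aluv.
Qed.

(** Finitely many generating pairs suffice for compactness; indexing them by a
    finite type fits both a single pair and one pair per operation symbol. *)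
Lemma compact_cgen (T : finType) (f g : T -> A) :
  compact_con (cgen (fun x y => exists2 t, f t = x & g t = y)).
Proof.
move=> F h.
have {}h t : exists G : set (con A),
    [/\ finite_set G, G `<=` F & csup G (f t) (g t)].
  by apply: csup_finitary; apply: h; apply: cgen_in; exists t.
have [G hG] := choice h.
exists (\bigcup_(t in [set: T]) G t); split.
- by apply: bigcup_finite => [|t _]; [exact: finite_finset|case: (hG t)].
- by move=> al [t _]; case: (hG t) => _ + _; apply.
- apply: cgen_le => _ _ [t <- <-]; case: (hG t) => _ _; apply: csup_mono.
  by move=> al Gal; exists t.
Qed.

Definition principal (x y : A) : con A :=
  cgen (fun u v => exists2 t : unit, x = u & y = v).

Lemma compact_principal x y : compact_con (principal x y).
Proof. exact: (@compact_cgen unit (fun=> x) (fun=> y)). Qed.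

Lemma principal_le x y theta : principal x y <=c theta <-> theta x y.
Proof.
split=> [|h]; first by apply; apply: cgen_in; exists tt.
by apply: cgen_le => _ _ [_ <- <-].
Qed.

Lemma csup_chain_finite (F G : set (con A)) : F !=set0 ->
  total_on F (@con_le S A) -> finite_set G -> G `<=` F ->
  exists2 alpha, F alpha & csup G <=c alpha.
Proof.
move=> F0 Ftot /(@finite_seqP {classic (con A)}) [s ->] {G}.
elim: s => [_|al s IH hs].
  have [al Fal] := F0; exists al => //.
  by apply: csup_le => be /=; rewrite in_nil.
have [be bes|be Fbe sbe] := IH; first by apply: hs; rewrite /= in_cons bes orbT.
have Fal : F al by apply: hs; rewrite /= in_cons eqxx.
have [albe|beal] := Ftot _ _ Fal Fbe; [exists be|exists al] => //.
  apply: csup_le => ga /=; rewrite in_cons => /orP [/eqP -> //|gas].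
  by apply: cle_trans sbe; apply: csup_ub.
apply: csup_le => ga /=; rewrite in_cons => /orP [/eqP -> //|gas].
by apply: cle_trans beal; apply: cle_trans sbe; apply: csup_ub.
Qed.

Lemma compact_chain (F : set (con A)) sigma : compact_con sigma -> F !=set0 ->
  total_on F (@con_le S A) -> sigma <=c csup F ->
  exists2 alpha, F alpha & sigma <=c alpha.
Proof.
move=> cs F0 Ftot /cs [G [fG GF sG]].
have [al Fal Gal] := csup_chain_finite F0 Ftot fG GF.
by exists al => //; apply: cle_trans Gal.
Qed.

End Lattice.

Lemma con_img_le (S : signature) (A B : algebra S) (f : hom A B)
    (theta : con A) (gamma : con B) :
  theta <=c con_preim f gamma -> con_img f theta <=c gamma.
Proof. by move=> h; apply: cgen_le => _ _ [a [b [hab <- <-]]]; apply: h. Qed.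

Lemma con_img_in (S : signature) (A B : algebra S) (f : hom A B)
    (theta : con A) : theta <=c con_preim f (con_img f theta).
Proof. by move=> a b h; apply: cgen_in; exists a, b. Qed.

Lemma con_preim_img (S : signature) (A B : algebra S) (f : hom A B)
    (theta : con A) : surjective f -> con_ker f <=c theta ->
  con_preim f (con_img f theta) = theta.
Proof.
move=> fs kt; apply: con_le_anti; last exact: con_img_in.
move=> x y /= /(con_imgE fs kt) [a [b [tab ea eb]]].
by apply: con_trans (con_trans (kt _ _ _) tab) (kt _ _ _); [exact: esym|].
Qed.

(** Zorn's lemma inside a property, above a given element; upper bounds are
    only demanded of nonempty chains. *)
Lemma Zorn_above (T : Type) (R : T -> T -> Prop) (P : T -> Prop) (t0 : T) :
  (forall t, R t t) -> (forall r s t, R r s -> R s t -> R r t) ->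
  (forall s t, R s t -> R t s -> s = t) -> P t0 ->
  (forall F : set T, F !=set0 -> F `<=` P -> total_on F R ->
    exists2 t, P t & forall s, F s -> R s t) ->
  exists t, [/\ P t, R t0 t & forall s, P s -> R t s -> s = t].
Proof.
move=> Rr Rt Ra P0 ub.
pose U := {t : T | P t /\ R t0 t}.
pose R' (u v : U) := `[< R (sval u) (sval v) >].
have [|u v w /asboolP h1 /asboolP h2|u v /asboolP h1 /asboolP h2|F Ftot|t mt]
  := @Zorn U R'.
- by move=> u; apply/asboolP.
- by apply/asboolP; apply: Rt h1 h2.
- by case: u v h1 h2 => [x px] [y py] h1 h2; apply: eq_exist; apply: Ra.
- have [->|/set0P F0] := eqVneq F set0.
    by exists (exist _ t0 (conj P0 (Rr t0))).
  have [|_ [u _ <-]|_ _ [u Fu <-] [v Fv <-]|t Pt ht] := ub (sval @` F).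
  + by have [u Fu] := F0; exists (sval u); exists u.
  + by case: (svalP u).
  + by case: (Ftot _ _ Fu Fv) => /asboolP; [left|right].
  + have R0t : R t0 t.
      have [u Fu] := F0; apply: (Rt _ (sval u)); first by case: (svalP u).
      by apply: ht; exists u.
    by exists (exist _ t (conj Pt R0t)) => u Fu; apply/asboolP; apply: ht; exists u.
exists (sval t); have [Pt R0t] := svalP t; split=> // s Ps Rts.
have R0s := Rt _ _ _ R0t Rts.
by have /(congr1 sval) := mt (exist _ s (conj Ps R0s)) (asboolT Rts).
Qed.

(** * Quotients and semidegeneracy *)

Section Quotient.
Variables (S : signature) (A : algebra S) (theta : con A).

(** The elements are the blocks of [theta], as predicates on [A]. *)
Definition block := {P : A -> Prop | exists a, P = theta a}.

Definition to_block (a : A) : block :=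
  exist _ (theta a : A -> Prop) (ex_intro _ a erefl).

Lemma to_blockE a b : to_block a = to_block b <-> theta a b.
Proof.
split=> [/(congr1 sval) /= ->|h]; first exact: con_refl.
apply: eq_exist; apply/funext => z; apply/propext; split.
- by apply: con_trans; apply: con_sym.
- exact: con_trans.
Qed.

Lemma to_block_surj (p : block) : exists a, to_block a = p.
Proof. by case: p => P [a Pa]; exists a; apply: eq_exist. Qed.

Definition block_repr (p : block) : A := sval (cid (to_block_surj p)).

Lemma block_reprK p : to_block (block_repr p) = p.
Proof. exact: (svalP (cid (to_block_surj p))). Qed.

Lemma block_inhabited : inhabited block.
Proof. by case: (carrier_nonempty A) => a; exists; apply: to_block a. Qed.

Definition quot : algebra S :=
  @Algebra S block (fun o ps => to_block (op (fun i => block_repr (ps i))))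
    block_inhabited.

Definition quot_proj : hom A quot.
Proof.
exists (to_block : A -> quot) => o a; apply/to_blockE.
by apply: con_op => i; apply/to_blockE; rewrite block_reprK.
Defined.

Lemma quot_proj_surj : surjective quot_proj.
Proof. exact: to_block_surj. Qed.

Lemma quot_proj_ker : con_ker quot_proj = theta.
Proof. by apply: con_le_anti => x y /to_blockE. Qed.

End Quotient.

Lemma eval_hom (S : signature) (A B : algebra S) (f : hom A B) v t :
  f (eval v t) = eval (fun n => f (v n)) t.
Proof.
by elim: t => //= o ts IH; rewrite homP; congr op; apply/funext.
Qed.

Lemma quot_in_variety (S : signature) (V : variety S) (A : algebra S)
  (theta : con A) : in_variety V A -> in_variety V (quot theta).
Proof.
move=> VA s t Vst v.
have -> : v = fun n => quot_proj theta (block_repr (v n)).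
  by apply/funext => n; rewrite /= block_reprK.
by rewrite -!eval_hom (VA _ _ Vst).
Qed.

(** A block closed under the operations is a one-element subalgebra of the
    quotient, which is therefore trivial. *)
Lemma semidegenerate_block (S : signature) (V : variety S) (A : algebra S)
    (theta : con A) (x : A) : semidegenerate V -> in_variety V A ->
  (forall o : sym S, theta x (op (fun _ : 'I_(arity o) => x))) ->
  theta = ctop A.
Proof.
move=> sd VA h; apply: con_le_anti => // a b _.
apply: contrapT => nab; apply: (sd _ (quot_in_variety (theta := theta) VA)).
  by move=> triv; apply: nab; apply/to_blockE; apply: triv.
exists (to_block theta x) => o p hp.
have -> : p = fun=> quot_proj theta x by apply/funext => i; apply: hp.
by rewrite -homP; apply/esym/to_blockE.
Qed.

(** Collapsing the subuniverse condition at a point collapses the algebra: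
    as there are finitely many operations, the pairs asserting that [x] is
    idempotent for each of them generate a compact congruence. *)
Lemma compact_top (S : signature) (V : variety S) (A : algebra S) :
  semidegenerate V -> in_variety V A -> compact_con (ctop A).
Proof.
move=> sd VA; case: (carrier_nonempty A) => x.
rewrite -(@semidegenerate_block S V A
  (cgen (fun u v => exists2 o : sym S, x = u & op (fun _ : 'I_(arity o) => x) = v))
  x sd VA); first exact: compact_cgen.
by move=> o; apply: cgen_in; exists o.
Qed.

(** * Congruences as algebras *)

Section ConAlg.
Variables (S : signature) (A : algebra S).
Implicit Types alpha beta : con A.

Lemma con_alg_inhabited alpha : inhabited {p : A * A | alpha p.1 p.2}.
Proof.
by case: (carrier_nonempty A) => x; exists; exists (x, x); apply: con_refl.
Qed.

(** [alpha] as a subalgebra of [A * A]. *)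
Definition con_alg alpha : algebra S :=
  @Algebra S {p : A * A | alpha p.1 p.2}
    (fun o ps => exist _ (op (fun i => (sval (ps i)).1),
                          op (fun i => (sval (ps i)).2))
                   (con_op (fun i => svalP (ps i))))
    (con_alg_inhabited alpha).

Definition cpair alpha x y (h : alpha x y) : con_alg alpha :=
  exist _ (x, y) h.

Definition cfst alpha : hom (con_alg alpha) A.
Proof. by exists (fun p : con_alg alpha => (sval p).1). Defined.

Definition csnd alpha : hom (con_alg alpha) A.
Proof. by exists (fun p : con_alg alpha => (sval p).2). Defined.

Lemma con_algP alpha (p : con_alg alpha) : alpha (cfst alpha p) (csnd alpha p).
Proof. exact: (svalP p). Qed.

Lemma con_alg_ext alpha (p q : con_alg alpha) :
  cfst alpha p = cfst alpha q -> csnd alpha p = csnd alpha q -> p = q.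
Proof.
by case: p q => [[a b] h] [[c d] k] /= e1 e2; apply: eq_exist; rewrite e1 e2.
Qed.

Lemma con_alg_eta alpha (p : con_alg alpha) : cpair (con_algP p) = p.
Proof. exact: con_alg_ext. Qed.

Definition cdiag alpha : hom A (con_alg alpha).
Proof.
by exists (fun x => cpair (con_refl alpha x)) => o a; apply: con_alg_ext.
Defined.

Definition cswap alpha : hom (con_alg alpha) (con_alg alpha).
Proof.
exists (fun p : con_alg alpha => cpair (con_sym (con_algP p))) => o a.
exact: con_alg_ext.
Defined.

Lemma con_alg_in_variety (V : variety S) alpha :
  in_variety V A -> in_variety V (con_alg alpha).
Proof.
by move=> VA s t Vst v; apply: con_alg_ext; rewrite !eval_hom; apply: VA.
Qed.

(** The congruence written Delta_(alpha, beta) in commutator theory. *)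
Definition Delta alpha beta : con (con_alg alpha) := con_img (cdiag alpha) beta.

(** The commutator of Hagemann and Herrmann. *)
Definition hcomm alpha beta : con A :=
  con_img (csnd alpha) (Delta alpha beta /\c con_ker (cfst alpha)).

Definition both alpha delta : con (con_alg alpha) :=
  con_preim (cfst alpha) delta /\c con_preim (csnd alpha) delta.

Lemma Delta_fst alpha beta :
  Delta alpha beta <=c con_preim (cfst alpha) beta.
Proof. by apply: con_img_le. Qed.

Lemma Delta_snd alpha beta :
  Delta alpha beta <=c con_preim (csnd alpha) beta.
Proof. by apply: con_img_le. Qed.

Lemma Delta_diag alpha beta x y : beta x y ->
  Delta alpha beta (cdiag alpha x) (cdiag alpha y).
Proof. exact: con_img_in. Qed.

Lemma Delta_mono alpha beta beta' : beta <=c beta' ->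
  Delta alpha beta <=c Delta alpha beta'.
Proof. by move=> h; apply: con_img_le => x y /h; apply: con_img_in. Qed.

Lemma hcomm_le alpha beta (theta : con A) :
  (forall p q, Delta alpha beta p q -> cfst alpha p = cfst alpha q ->
     theta (csnd alpha p) (csnd alpha q)) ->
  hcomm alpha beta <=c theta.
Proof. by move=> h; apply: con_img_le => p q [h1 h2]; apply: h. Qed.

Lemma hcomm_in alpha beta p q :
  Delta alpha beta p q -> cfst alpha p = cfst alpha q ->
  hcomm alpha beta (csnd alpha p) (csnd alpha q).
Proof. by move=> h1 h2; apply: (con_img_in (f := csnd alpha)). Qed.

Lemma hcomm_meet alpha beta : hcomm alpha beta <=c alpha /\c beta.
Proof.
apply: hcomm_le => p q Dpq e; split; last exact: Delta_snd Dpq.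
by apply: con_trans (con_algP q); rewrite -e; apply: con_sym (con_algP p).
Qed.

Lemma hcomm_mono2 alpha beta beta' : beta <=c beta' ->
  hcomm alpha beta <=c hcomm alpha beta'.
Proof.
by move=> h; apply: hcomm_le => p q /(Delta_mono h); apply: hcomm_in.
Qed.

End ConAlg.

(** * The Hagemann-Herrmann commutator in modular varieties *)

Section Modular.
Variables (S : signature) (V : variety S) (V_modular : congruence_modular V).

(** If [p] and [q] are [Delta]-related with
    [delta]-related first coordinates, the diagonal pairs over these first
    coordinates are related by both [Delta] and [both alpha delta]; they link
    [p] to [q] through two steps that fix the first coordinate, and modularity
    turns this into a path along which second coordinates only move by
    [delta]. *)
Lemma Delta_collapse (A : algebra S) (VA : in_variety V A)
    (alpha beta delta : con A) p q :
  hcomm alpha beta <=c delta ->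
  (both alpha delta \/c Delta alpha beta) p q ->
  delta (cfst alpha p) (cfst alpha q) -> delta (csnd alpha p) (csnd alpha q).
Proof.
move=> hd; have VAa := con_alg_in_variety (alpha := alpha) VA.
set K := both _ _; set D := Delta _ _; set E := con_ker (cfst alpha).
have step : D /\c con_preim (cfst alpha) delta <=c con_preim (csnd alpha) delta.
  move=> {}p {}q [Dpq dpq].
  have bpq := Delta_fst Dpq.
  have : ((D /\c K) \/c (E /\c D)) p q.
    rewrite (V_modular VAa); last by move=> x y [].
    split=> //.
    apply: (con_trans (y := cdiag alpha (cfst alpha p))).
      by apply: cjoinr.
    apply: (con_trans (y := cdiag alpha (cfst alpha q))).
      apply: cjoinl; split; last by split.
      exact: Delta_diag.
    by apply: cjoinr.
  apply: cjoin_le => u v; first by case=> _ [].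
  by case=> e Duv; apply: hd; apply: hcomm_in.
move=> KD d0.
have : (K \/c (D /\c con_preim (cfst alpha) delta)) p q.
  by rewrite (V_modular VAa); [split|move=> x y []].
by apply: (cjoin_le (gamma := con_preim (csnd alpha) delta)) => // u v [].
Qed.

(** Commuting with joins in the second argument, up to the joined congruence:
    identifying the diagonal along [kappa] stays inside [both alpha delta]
    as soon as [delta] contains [kappa]. *)
Lemma hcomm_join2 (A : algebra S) (VA : in_variety V A)
    (alpha beta kappa : con A) :
  hcomm alpha (beta \/c kappa) <=c hcomm alpha beta \/c kappa.
Proof.
set delta := hcomm _ _ \/c kappa.
have le : Delta alpha (beta \/c kappa) <=c both alpha delta \/c Delta alpha beta.
  apply: con_img_le; apply: cjoin_le => x y h.
  - by apply: cjoinr; apply: Delta_diag.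
  - by apply: cjoinl; split; apply: cjoinr.
apply: hcomm_le => p q /le Dpq e.
apply: (Delta_collapse VA _ Dpq).
- exact: cjoinl.
- by rewrite e; apply: con_refl.
Qed.

(** Matrices glue along a common side: relations between [(x, x')]
    and [(y, y')], and between [(x', x'')] and [(y', y'')], yield one between
    [(x, x'')] and [(y, y'')]. This is Gumm's shifting lemma in the algebra of
    [beta]-triples, represented as pairs of elements of [beta] with the same
    first component: replacing the third entry of each triple by its second
    one moves it along the kernel of the first two coordinates, and
    [Delta_collapse] provides the hypothesis of the shifting lemma. *)
Lemma Delta_compose (A : algebra S) (VA : in_variety V A)
    (alpha beta delta : con A) (x x' x'' y y' y'' : A)
    (h01 : beta x x') (h12 : beta x' x'') (h02 : beta x x'')
    (k01 : beta y y') (k12 : beta y' y'') (k02 : beta y y'') :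
  hcomm beta alpha <=c delta -> alpha x' y' ->
  (both beta delta \/c Delta beta alpha) (cpair h01) (cpair k01) ->
  (both beta delta \/c Delta beta alpha) (cpair h12) (cpair k12) ->
  (both beta delta \/c Delta beta alpha) (cpair h02) (cpair k02).
Proof.
set Theta := both beta delta \/c Delta beta alpha => hd axy H01 H12.
pose T := con_alg (con_ker (cfst beta)).
have VT : in_variety V T by do 2![apply: con_alg_in_variety].
have t_rel (t : T) : beta (csnd beta (cfst _ t)) (csnd beta (csnd _ t)).
  case: t => [[[[a b] /= ab] [[c d] /= cd]] /= e].
  move: e; rewrite /con_ker /= => e; subst c.
  exact: con_trans (con_sym ab) cd.
pose f12 (t : T) : con_alg beta := cpair (t_rel t).
have f12P (o : sym S) (a : 'I_(arity o) -> T) :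
    f12 (op a) = op (fun i => f12 (a i)) by apply: con_alg_ext.
pose g12 : hom T (con_alg beta) := Hom f12P.
pose T02 := con_preim (csnd (con_ker (cfst beta))) Theta.
pose T12 := con_preim g12 Theta.
pose E := con_ker (cfst (con_ker (cfst beta))).
pose mk a b c (ab : beta a b) (ac : beta a c) : T :=
  @cpair _ _ (con_ker (cfst beta)) (cpair ab) (cpair ac) erefl.
pose X := mk _ _ _ h01 h02; pose X0 := mk _ _ _ h01 h01.
pose Y := mk _ _ _ k01 k02; pose Y0 := mk _ _ _ k01 k01.
suff: T02 X Y by [].
(* Theta may be used on the second and third coordinates of X0 and Y0, which
   agree, because Delta relates diagonal pairs along alpha. *)
have : ((T12 /\c T02) \/c (E /\c T12)) X Y.
  rewrite (V_modular VT); last by move=> ? ? [].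
  split; last first.
    rewrite /T12 /=.
    by have [-> ->] : f12 X = cpair h12 /\ f12 Y = cpair k12
      by split; apply: con_alg_ext.
  apply: (con_trans (y := X0)); first by apply: cjoinr.
  apply: (con_trans (y := Y0)); last by apply: cjoinr.
  apply: cjoinl; split; last exact: H01.
  rewrite /T12 /=.
  have [-> ->] : f12 X0 = cdiag beta x' /\ f12 Y0 = cdiag beta y'
    by split; apply: con_alg_ext.
  by apply: cjoinr; apply: Delta_diag.
apply: cjoin_le => u v; first by case.
case=> Euv T12uv.
have euv : cfst _ u = cfst _ v by [].
(* u and v agree on the first two coordinates, so their third ones are
   delta-related. *)
have d : delta (csnd beta (g12 u)) (csnd beta (g12 v)).
  apply: (Delta_collapse VA hd T12uv) => /=.
  have -> : (sval (sval u).1).2 = (sval (sval v).1).2.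
    by rewrite -[(sval u).1]/(cfst _ u) euv.
  exact: con_refl.
apply: cjoinl; split=> //.
have e02 (t : T) : cfst beta (cfst _ t) = cfst beta (csnd _ t) := con_algP t.
have e : cfst beta (csnd _ u) = cfst beta (csnd _ v) by rewrite -!e02 euv.
change (delta (cfst beta (csnd _ u)) (cfst beta (csnd _ v))).
by rewrite e; apply: con_refl.
Qed.

(** Transposing a matrix with rows in [alpha] and columns in [beta] turns the
    generators of [Delta alpha beta] into trivial pairs. The transposed
    relation is a congruence by [Delta_compose], hence contains
    [Delta alpha beta]. *)
Lemma hcomm_sym_le (A : algebra S) (VA : in_variety V A) (alpha beta : con A) :
  hcomm alpha beta <=c hcomm beta alpha.
Proof.
set delta := hcomm beta alpha.
pose Theta := both beta delta \/c Delta beta alpha.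
pose R (p q : con_alg alpha) := exists u v : con_alg beta, Theta u v /\
  [/\ cfst _ u = cfst _ p, csnd _ u = cfst _ q, cfst _ v = csnd _ p
    & csnd _ v = csnd _ q].
have Theta_swap : Theta <=c con_preim (cswap beta) Theta.
  apply: cjoin_le.
    by move=> u v [h1 h2]; apply: cjoinl.
  apply: con_img_le => x y h; apply: cjoinr.
  have e z : cswap beta (cdiag beta z) = cdiag beta z by apply: con_alg_ext.
  change (Delta beta alpha (cswap beta (cdiag beta x)) (cswap beta (cdiag beta y))).
  by rewrite !e; apply: Delta_diag.
have R1 p : R p p.
  exists (cdiag beta (cfst _ p)), (cdiag beta (csnd _ p)); split=> //.
  by apply: cjoinr; apply: Delta_diag; apply: (con_algP p).
have R2 p q : R p q -> R q p.
  move=> [u [v [/Theta_swap h [e1 e2 e3 e4]]]].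
  by exists (cswap beta u), (cswap beta v).
have R3 p q r : R p q -> R q r -> R p r.
  move=> [u [v [h [e1 e2 e3 e4]]]] [u' [v' [h' [e1' e2' e3' e4']]]].
  have ax : alpha (csnd _ u) (csnd _ v) by rewrite e2 e4; apply: con_algP.
  have c : beta (csnd _ u) (csnd _ u') by rewrite e2 -e1'; apply: con_algP.
  have d : beta (csnd _ v) (csnd _ v') by rewrite e4 -e3'; apply: con_algP.
  have eu' : u' = cpair c by apply: con_alg_ext; rewrite // e1' -e2.
  have ev' : v' = cpair d by apply: con_alg_ext; rewrite // e3' -e4.
  exists (cpair (con_trans (con_algP u) c)), (cpair (con_trans (con_algP v) d)).
  split; last by split.
  apply: (Delta_compose VA (h01 := con_algP u) (h12 := c) (k01 := con_algP v)
    (k12 := d) (con_trans _ c) (con_trans _ d) _ ax) => //.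
  - by rewrite !con_alg_eta.
  - by rewrite -eu' -ev'.
have R4 (o : sym S) (p q : 'I_(arity o) -> con_alg alpha) :
    (forall i, R (p i) (q i)) -> R (op p) (op q).
  move=> /choice [u] /choice [v] h; exists (op u), (op v); split.
    by apply: con_op => i; case: (h i).
  by split; rewrite !homP; congr op; apply/funext => i; case: (h i) => _ [].
have DR : Delta alpha beta <=c Con R1 R2 R3 R4.
  apply: con_img_le => x y bxy.
  by exists (cpair bxy), (cpair bxy); split=> //; apply: con_refl.
apply: hcomm_le => p q /DR [u [v [uv [e1 e2 e3 e4]]]] e.
(* p and q have the same first coordinate, so transposing them produces a
   diagonal pair u, itself Delta-related to the diagonal pair over csnd p. *)
have {}e1 : u = cdiag beta (cfst _ p) by apply: con_alg_ext; rewrite ?e2 ?e1 ?e.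
rewrite -[csnd _ p]/(csnd beta (cdiag beta (csnd _ p))) -e4.
apply: (Delta_collapse VA (beta := alpha)) => //; last first.
  by rewrite e3; apply: con_refl.
apply: con_trans uv; rewrite e1; apply: cjoinr; apply: Delta_diag.
by apply: con_sym; apply: (con_algP p).
Qed.

Lemma hcomm_mono (A : algebra S) (VA : in_variety V A)
    (alpha alpha' beta beta' : con A) :
  alpha <=c alpha' -> beta <=c beta' -> hcomm alpha beta <=c hcomm alpha' beta'.
Proof.
move=> ha hb; apply: cle_trans (hcomm_mono2 (alpha := alpha) hb) _.
apply: cle_trans (hcomm_sym_le VA (alpha := alpha) (beta := beta')) _.
apply: cle_trans (hcomm_mono2 (alpha := beta') ha) _.
exact: hcomm_sym_le.
Qed.

Lemma hcomm_join (A : algebra S) (VA : in_variety V A)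
    (alpha beta kappa : con A) :
  hcomm (alpha \/c kappa) (beta \/c kappa) <=c hcomm alpha beta \/c kappa.
Proof.
apply: cle_trans (hcomm_join2 VA (beta := beta) (kappa := kappa)) _.
apply: cjoin_le; last exact: cjoinr.
apply: cle_trans (hcomm_sym_le VA (alpha := _ \/c _) (beta := beta)) _.
apply: cle_trans (hcomm_join2 VA (beta := alpha) (kappa := kappa)) _.
by apply: cjoin_mono => //; apply: hcomm_sym_le.
Qed.

Section Image.
Variables (A B : algebra S) (f : hom A B) (f_surj : surjective f).
Variables (alpha beta : con A).
Hypotheses (VA : in_variety V A) (ka : con_ker f <=c alpha).
Hypothesis (kb : con_ker f <=c beta).

Definition con_alg_map : hom (con_alg alpha) (con_alg (con_img f alpha)).
Proof.
exists (fun p : con_alg alpha => @cpair _ _ (con_img f alpha) _ _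
  (con_img_in (f := f) (con_algP p))) => o a.
by apply: con_alg_ext; rewrite /= homP.
Defined.

Lemma con_alg_map_surj : surjective con_alg_map.
Proof.
move=> q; have /(con_imgE f_surj ka) [x [y [axy e1 e2]]] := con_algP q.
by exists (cpair axy); apply: con_alg_ext.
Qed.

Lemma con_alg_map_ker : con_ker con_alg_map <=c both alpha (con_ker f).
Proof.
move=> p q e; split.
- exact: (congr1 (cfst (con_img f alpha)) e).
- exact: (congr1 (csnd (con_img f alpha)) e).
Qed.

Lemma hcomm_img :
  hcomm alpha beta \/c con_ker f =
  con_preim f (hcomm (con_img f alpha) (con_img f beta)).
Proof.
set alphaB := con_img f alpha; set betaB := con_img f beta.
set delta := hcomm _ _ \/c _.
have kd : con_ker f <=c delta by apply: cjoinr.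
apply: con_le_anti.
  apply: cjoin_le; last first.
    move=> x y e; change (hcomm alphaB betaB (f x) (f y)).
    by have -> : f x = f y := e; apply: con_refl.
  have DD : Delta alpha beta <=c con_preim con_alg_map (Delta alphaB betaB).
    apply: con_img_le => x y h.
    have e z : con_alg_map (cdiag alpha z) = cdiag alphaB (f z)
      by apply: con_alg_ext.
    change (Delta alphaB betaB (con_alg_map (cdiag alpha x))
      (con_alg_map (cdiag alpha y))).
    by rewrite !e; apply: Delta_diag; apply: con_img_in h.
  apply: hcomm_le => p q /DD Dpq e.
  exact: (hcomm_in Dpq (congr1 f e)).
(* The kernel of f being absorbed by delta, Delta on the image lifts to Theta,
   to which the collapse applies. *)
suff le : hcomm alphaB betaB <=c con_img f delta.
  by move=> x y /le h; rewrite -(con_preim_img f_surj kd).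
pose Theta := both alpha delta \/c Delta alpha beta.
have kT : con_ker con_alg_map <=c Theta.
  apply: cle_trans con_alg_map_ker _; apply: cle_trans (@cjoinl _ _ _ _).
  by move=> p q [h1 h2]; split; apply: kd.
have DT : Delta alphaB betaB <=c con_img con_alg_map Theta.
  apply: con_img_le => x y /(con_imgE f_surj kb) [a [b [bab <- <-]]].
  have e z : cdiag alphaB (f z) = con_alg_map (cdiag alpha z)
    by apply: con_alg_ext.
  change (con_img con_alg_map Theta (cdiag alphaB (f a)) (cdiag alphaB (f b))).
  rewrite !e; apply: con_img_in.
  by apply: cjoinr; apply: Delta_diag.
apply: hcomm_le => u v /DT.
move=> /(con_imgE con_alg_map_surj kT) [p [q [pq <- <-]]] e.
apply: (con_img_in (f := f)); apply: (Delta_collapse VA _ pq).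
- exact: cjoinl.
- exact: kd.
Qed.

End Image.

Lemma hcomm_commutator_like : commutator_like V (@hcomm S).
Proof.
move=> A B f VA VB fs alpha beta; split; first exact: hcomm_meet.
rewrite -hcomm_img //; try exact: cjoinr.
apply: con_le_anti; apply: cjoin_le; try exact: cjoinr.
- apply: cle_trans (@cjoinl _ _ _ _).
  by apply: hcomm_mono => //; apply: cjoinl.
- exact: hcomm_join.
Qed.

End Modular.

(** In [A * A] modulo [Delta] the diagonal is a block closed under the
    operations, so semidegeneracy collapses everything. *)
Lemma hcomm_top (S : signature) (V : variety S) (A : algebra S) :
  semidegenerate V -> in_variety V A ->
  hcomm (ctop A) (ctop A) = ctop A.
Proof.
move=> sd VA; case: (carrier_nonempty A) => a.
have VT := con_alg_in_variety (alpha := ctop A) VA.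
have D1 : Delta (ctop A) (ctop A) = ctop _.
  apply: (semidegenerate_block (x := cdiag (ctop A) a) sd VT) => o.
  rewrite -homP; exact: Delta_diag.
apply: con_le_anti => // x y _.
have h z : ctop A a z by [].
by apply: (hcomm_in (p := cpair (h x)) (q := cpair (h y))); rewrite ?D1.
Qed.

(** * The greatest commutator operation *)

Lemma con_img_preim (S : signature) (A B : algebra S) (f : hom A B)
    (gamma : con B) : surjective f -> con_img f (con_preim f gamma) = gamma.
Proof.
move=> fs; apply: con_le_anti; first exact: con_img_le.
move=> x y; have [a <-] := fs x; have [b <-] := fs y => h.
exact: (con_img_in (f := f) (theta := con_preim f gamma)).
Qed.

Lemma con_img_mono (S : signature) (A B : algebra S) (f : hom A B)
    (alpha beta : con A) : alpha <=c beta -> con_img f alpha <=c con_img f beta.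
Proof. by move=> h; apply: con_img_le => x y /h; apply: con_img_in. Qed.

Section Greatest.
Variables (S : signature) (V : variety S) (V_modular : congruence_modular V).
Variables (comm : con_operation S) (comm_commutator : is_commutator V comm).

Lemma comm_meet (A : algebra S) (VA : in_variety V A) (alpha beta : con A) :
  comm alpha beta <=c alpha /\c beta.
Proof.
have [C _] := comm_commutator.
have id_surj : surjective (@Hom S A A id (fun _ _ => erefl)).
  by move=> x; exists x.
by have [] := C _ _ _ VA VA id_surj alpha beta.
Qed.

(** The least monotone operation above [comm]. It is again one of the
    operations among which [comm] is greatest, which makes [comm] monotone. *)
Definition comm_hull : con_operation S := fun A alpha beta =>
  csup [set gamma | exists alpha' beta',
    [/\ alpha' <=c alpha, beta' <=c beta & gamma = comm alpha' beta']].

(** Take [alpha'] to be the meet of [alpha] with the preimage of [gamma];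
    modularity lets its join with the kernel distribute over that meet. *)
Lemma con_img_below (A B : algebra S) (f : hom A B) (VA : in_variety V A)
    (fs : surjective f) (alpha : con A) (gamma : con B) :
  gamma <=c con_img f (alpha \/c con_ker f) ->
  exists2 alpha', alpha' <=c alpha & con_img f (alpha' \/c con_ker f) = gamma.
Proof.
move=> h; exists (alpha /\c con_preim f gamma); first by move=> x y [].
rewrite cjoinC (V_modular VA); last first.
  move=> x y e; change (gamma (f x) (f y)).
  by have -> : f x = f y := e; apply: con_refl.
rewrite cjoinC -[RHS](con_img_preim gamma fs); congr con_img.
apply: con_le_anti => [x y []//|x y g]; split=> //.
by rewrite -(con_preim_img fs (@cjoinr _ _ alpha _)); apply: h.
Qed.

Lemma comm_hull_commutator_like : commutator_like V comm_hull.
Proof.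
have [C _] := comm_commutator.
move=> A B f VA VB fs alpha beta; split.
  apply: csup_le => _ [al [be [h1 h2 ->]]] x y /(comm_meet VA) [/h1 ? /h2 ?].
  by split.
apply: con_le_anti.
  apply: cjoin_le.
    apply: csup_le => _ [al [be [h1 h2 ->]]].
    have [_ e] := C _ _ _ VA VB fs al be.
    apply: cle_trans (@cjoinl _ _ _ (con_ker f)) _; rewrite e.
    have le : comm (con_img f (al \/c con_ker f)) (con_img f (be \/c con_ker f))
        <=c comm_hull (con_img f (alpha \/c con_ker f))
              (con_img f (beta \/c con_ker f)).
      apply: csup_ub; exists (con_img f (al \/c con_ker f)).
      exists (con_img f (be \/c con_ker f)); split=> //.
      + by apply: con_img_mono; apply: cjoin_mono.
      + by apply: con_img_mono; apply: cjoin_mono.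
    by move=> x y; apply: le.
  move=> x y e.
  change (comm_hull (con_img f (alpha \/c con_ker f))
    (con_img f (beta \/c con_ker f)) (f x) (f y)).
  by have -> : f x = f y := e; apply: con_refl.
rewrite -[X in _ <=c X](con_preim_img fs); last exact: cjoinr.
move=> x y; apply: csup_le => _ [ga [de [h1 h2 ->]]].
have [al hal <-] := con_img_below VA fs h1.
have [be hbe <-] := con_img_below VA fs h2.
have [_ e] := C _ _ _ VA VB fs al be.
rewrite -[X in X <=c _](con_img_preim _ fs) -e; apply: con_img_mono.
apply: cjoin_mono => //; apply: csup_ub.
by exists al, be.
Qed.

Lemma comm_mono (A : algebra S) (VA : in_variety V A)
    (alpha alpha' beta beta' : con A) :
  alpha <=c alpha' -> beta <=c beta' -> comm alpha beta <=c comm alpha' beta'.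
Proof.
have [_ G] := comm_commutator => h1 h2.
apply: cle_trans (G _ comm_hull_commutator_like _ VA _ _).
by apply: csup_ub; exists alpha, beta.
Qed.

(** Read in the quotient by [theta], where both sides have the same image. *)
Lemma comm_join (A : algebra S) (VA : in_variety V A)
    (alpha beta theta : con A) :
  comm (alpha \/c theta) (beta \/c theta) <=c comm alpha beta \/c theta.
Proof.
have [C _] := comm_commutator.
have VQ := quot_in_variety (theta := theta) VA.
have [_] := C _ _ _ VA VQ (@quot_proj_surj _ _ theta) (alpha \/c theta)
  (beta \/c theta).
have [_] := C _ _ _ VA VQ (@quot_proj_surj _ _ theta) alpha beta.
rewrite quot_proj_ker => -> e.
have jid gamma : (gamma \/c theta) \/c theta = gamma \/c theta.
  by apply: cjoin_idr; apply: cjoinr.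
by rewrite !jid in e; rewrite -e; apply: cjoinl.
Qed.

Lemma comm_top (A : algebra S) : semidegenerate V -> in_variety V A ->
  comm (ctop A) (ctop A) = ctop A.
Proof.
move=> sd VA; have [_ G] := comm_commutator.
apply: con_le_anti => //; rewrite -[X in X <=c _](hcomm_top sd VA).
exact: G (hcomm_commutator_like V_modular) _ VA _ _.
Qed.

End Greatest.

(** * Prime congruences *)

Section Primes.
Variables (S : signature) (A : algebra S) (c : con A -> con A -> con A).
Implicit Types alpha beta theta phi psi mu sigma : con A.

Lemma prime_inf (F : set (con A)) : F !=set0 -> total_on F (@con_le S A) ->
  (forall phi, F phi -> prime_con c phi) -> prime_con c (cinf F).
Proof.
move=> [phi0 F0] Ftot Fp; split.
  move=> e; have [+ _] := Fp _ F0; apply; apply: con_le_anti => //.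
  by rewrite -e => x y; apply.
move=> al be h; apply: contrapT => /not_orP [na nb].
have out ga : ~ ga <=c cinf F -> exists2 phi, F phi & ~ ga <=c phi.
  move=> n; apply: contrapT => m; apply: n => x y g phi Fphi.
  by apply: contrapT => nphi; apply: m; exists phi => // /(_ _ _ g).
have [phi Fphi aphi] := out _ na; have [psi Fpsi bpsi] := out _ nb.
have le chi : F chi -> c al be <=c chi by move=> Fchi x y /h; apply.
have [phipsi|psiphi] := Ftot _ _ Fphi Fpsi.
- have [a|b] := (Fp _ Fphi).2 _ _ (le _ Fphi).
    exact: aphi.
  by apply: bpsi; apply: cle_trans phipsi.
- have [a|b] := (Fp _ Fpsi).2 _ _ (le _ Fpsi); last exact: bpsi.
  by apply: aphi; apply: cle_trans psiphi.
Qed.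

Lemma min_prime_below phi : prime_con c phi ->
  exists2 psi, min_prime c psi & psi <=c phi.
Proof.
move=> pp.
have [|al be ga h1 h2|al be h1 h2|F F0 Fp Ftot|psi [ppsi le mpsi]] :=
  @Zorn_above (con A) (fun al be => be <=c al) (prime_con c) phi _ _ _ pp _.
- by move=> al.
- exact: cle_trans h2 h1.
- exact: con_le_anti.
- exists (cinf F); last by move=> al Fal x y; apply.
  by apply: prime_inf => // al be Fal Fbe; apply/or_comm; apply: Ftot.
- by exists psi => //; split=> // chi pchi lchi; apply: mpsi.
Qed.

Lemma O_con_le phi : prime_con c phi -> O_con c phi <=c phi.
Proof.
move=> [_ pp]; apply: csup_le => al [be [nbe e]].
by have [] := pp al be; rewrite ?e //; apply: cbot_le.
Qed.

Hypothesis c_meet : forall alpha beta, c alpha beta <=c alpha /\c beta.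
Hypothesis c_mono : forall alpha alpha' beta beta',
  alpha <=c alpha' -> beta <=c beta' -> c alpha beta <=c c alpha' beta'.
Hypothesis c_join : forall alpha beta theta,
  c (alpha \/c theta) (beta \/c theta) <=c c alpha beta \/c theta.

(** The analogue of the prime ideal theorem for m-systems. Compactness makes
    avoidance of [M] inductive, and a congruence maximal among those avoiding
    [M] is prime since two congruences strictly above it contain members of
    [M], whose commutator again contains a member of [M]. *)
Lemma prime_separation (M : set (con A)) theta : M !=set0 ->
  (forall sigma, M sigma -> compact_con sigma) ->
  (forall sigma tau, M sigma -> M tau ->
    exists2 rho, M rho & rho <=c c sigma tau) ->
  (forall sigma, M sigma -> ~ sigma <=c theta) ->
  exists phi, [/\ prime_con c phi, theta <=c phi
    & forall sigma, M sigma -> ~ sigma <=c phi].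
Proof.
move=> [s0 Ms0] Mc Mm M0.
have [||al be h1 h2|F F0 Fp Ftot|phi [pphi le mphi]] :=
  @Zorn_above (con A) (@con_le S A)
    (fun phi => forall sigma, M sigma -> ~ sigma <=c phi) theta _ _ _ M0 _.
- by move=> al.
- by move=> al be ga; apply: cle_trans.
- exact: con_le_anti.
- exists (csup F); last by move=> al; apply: csup_ub.
  move=> s Ms sF; have [al /Fp + sal] := compact_chain (Mc _ Ms) F0 Ftot sF.
  by move=> /(_ _ Ms); apply.
exists phi; split=> //; split.
  by move=> e; apply: (pphi _ Ms0); rewrite e.
have big al : ~ al <=c phi -> exists2 s, M s & s <=c al \/c phi.
  move=> n; apply: contrapT => m; apply: n.
  rewrite -(mphi (al \/c phi)); first exact: cjoinl.
  - by move=> s Ms sle; apply: m; exists s.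
  - exact: cjoinr.
move=> al be h; apply: contrapT => /not_orP [/big [s Ms sle] /big [t Mt tle]].
have [r Mr rle] := Mm _ _ Ms Mt; apply: (pphi _ Mr).
apply: cle_trans rle _; apply: cle_trans (c_mono sle tle) _.
by apply: cle_trans (@c_join _ _ _) _; apply: cjoin_le.
Qed.

Let pow alpha n := iter n (fun gamma => c gamma gamma) alpha.

Lemma comm_iter_diag alpha n : comm_iter c alpha alpha n = pow alpha n.
Proof. by case: n => // n; rewrite /pow iterSr. Qed.

Lemma pow_mono alpha beta n : alpha <=c beta -> pow alpha n <=c pow beta n.
Proof. by move=> h; elim: n => //= n IH; apply: c_mono. Qed.

Lemma pow_addl alpha m n : pow alpha (m + n) <=c pow alpha n.
Proof.
elim: m => //= m IH; apply: cle_trans IH.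
by move=> x y /c_meet [].
Qed.

Lemma pow_prime phi beta n : prime_con c phi -> pow beta n <=c phi ->
  beta <=c phi.
Proof.
move=> [_ pp]; elim: n => //= n IH /pp [] //.
Qed.

Hypothesis c_compact : compact_closed c.
Hypothesis c_star : star_condition c.

Lemma pow_compact alpha n : compact_con alpha -> compact_con (pow alpha n).
Proof. by move=> h; elim: n => //= n IH; apply: c_compact. Qed.

(** Otherwise the commutators in question, with [beta] ranging over the
    compact congruences not below [phi], form an m-system: this is the case
    of the second iterate in the star condition. A prime that avoids it is
    below [phi] and does not contain [alpha], against minimality. *)
Lemma min_prime_annihilator phi alpha : min_prime c phi ->
  compact_con alpha -> alpha <=c phi ->
  exists n beta, ~ beta <=c phi /\ c (pow alpha n) beta = cbot A.
Proof.
move=> [pphi mphi] ca aphi.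
pose M s := exists n beta, [/\ compact_con beta, ~ beta <=c phi
  & s = c (pow alpha n) (pow beta n)].
have M_in beta : compact_con beta -> ~ beta <=c phi -> M (c alpha beta).
  by move=> cb nb; exists 0, beta.
have M0 : exists2 beta, compact_con beta & ~ beta <=c phi.
  have [/not_top [x [y n]] _] := pphi; exists (principal x y).
  - exact: compact_principal.
  - by move=> /principal_le.
apply: contrapT => none.
have [|s [n [beta [cb nb ->]]]|s t|s [n [beta [cb nb ->]]] sle|theta] :=
  @prime_separation M (cbot A).
- by have [beta cb nb] := M0; exists (c alpha beta); apply: M_in.
- by apply: c_compact; apply: pow_compact.
- move=> [n [beta [cb nb ->]]] [n' [beta' [cb' nb' ->]]].
  (* A common bound for both exponents; pow is decreasing. *)
  pose N := n + n'; pose b := c beta beta'.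
  have compb : compact_con b by apply: c_compact.
  have nbb : ~ b <=c phi by have [_ pp] := pphi; move=> /pp [].
  have [|m] := c_star (pow_compact (n := N) ca) (pow_compact (n := N) compb)
    (n := 2) _; first by [].
  rewrite !comm_iter_diag /pow -!iterD -!/(pow _ _) /= => hm.
  exists (c (pow alpha (m + N)) (pow b (m + N))).
    by exists (m + N), b.
  apply: cle_trans hm _; apply: c_mono; apply: c_mono.
  + by rewrite /N addnC; apply: pow_addl.
  + rewrite /N addnC; apply: cle_trans (@pow_addl _ _ _) _; apply: pow_mono.
    by move=> x y /c_meet [].
  + exact: pow_addl.
  + apply: cle_trans (@pow_addl _ _ _) _; apply: pow_mono.
    by move=> x y /c_meet [].
- apply: none; exists n, (pow beta n); split.
  + by move=> /(pow_prime pphi).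
  + by apply: con_le_anti => //; apply: cbot_le.
move=> [ptheta _ avoid].
have le : theta <=c phi.
  move=> x y h; apply: contrapT => nphi.
  apply: (avoid (c alpha (principal x y))).
    apply: M_in; first exact: compact_principal.
    by move=> /principal_le.
  apply: (cle_trans (beta := principal x y)); last exact/principal_le.
  by move=> u v /c_meet [].
have [beta cb nb] := M0; apply: (avoid _ (M_in _ cb nb)).
rewrite (mphi _ ptheta le); apply: cle_trans aphi.
by move=> u v /c_meet [].
Qed.

(** As for the localisation of a ring at a minimal prime: an element of
    [phi] has an iterated commutator in [O phi], and a prime containing the
    latter contains the element. *)
Lemma min_prime_le_O phi mu : min_prime c phi -> prime_con c mu ->
  O_con c phi <=c mu -> phi <=c mu.
Proof.
move=> mp pmu le x y h; apply/principal_le.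
have [|n [beta [nb e]]] :=
  min_prime_annihilator mp (@compact_principal _ _ x y); first exact/principal_le.
apply: (pow_prime (n := n) pmu); apply: cle_trans le.
by apply: csup_ub; exists beta.
Qed.

End Primes.

Theorem theorem9p18 (S : signature) (V : variety S)
  (V_modular : congruence_modular V) (V_semidegenerate : semidegenerate V)
  (comm : con_operation S) (comm_commutator : is_commutator V comm)
  (A : algebra S) (A_in_V : in_variety V A)
  (A_compact_closed : compact_closed (comm A))
  (A_star : star_condition (comm A)) :
  mp_algebra (comm A) <->
  (forall phi psi : con A,
     min_prime (comm A) phi -> min_prime (comm A) psi -> phi <> psi ->
     O_con (comm A) phi \/c O_con (comm A) psi = ctop A).
Proof.
have c_meet := comm_meet comm_commutator A_in_V.
have c_mono := comm_mono V_modular comm_commutator A_in_V.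
have c_join := comm_join comm_commutator A_in_V.
have c_top := comm_top V_modular comm_commutator V_semidegenerate A_in_V.
split=> [mp phi psi mphi mpsi ne|H phi pphi].
  apply: contrapT => ntop; apply: ne.
  (* The singleton of the top congruence is an m-system, as [comm] fixes it. *)
  have [|_ ->|_ _ -> ->|_ -> le|mu [pmu le _]] :=
    prime_separation c_mono c_join (M := [set ctop A])
      (theta := O_con (comm A) phi \/c O_con (comm A) psi).
  - by exists (ctop A).
  - exact: compact_top V_semidegenerate A_in_V.
  - by exists (ctop A) => //; rewrite c_top.
  - by apply: ntop; apply: con_le_anti.
  have below chi : min_prime (comm A) chi -> O_con (comm A) chi <=c mu ->
      min_prime (comm A) chi /\ chi <=c mu.
    move=> mchi lchi; split=> //.
    exact: (min_prime_le_O c_meet c_mono c_join A_compact_closed A_star).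
  have [chi [_ uniq_chi]] := mp _ pmu.
  rewrite -(uniq_chi phi); last by apply: below => // x y h; apply/le/cjoinl.
  by apply: uniq_chi; apply: below => // x y h; apply/le/cjoinr.
have [psi mpsi le] := min_prime_below pphi; exists psi; split=> // chi [mchi lchi].
apply: contrapT => ne; have [+ _] := pphi; apply; apply: con_le_anti => //.
rewrite -(H _ _ mpsi mchi ne); apply: cjoin_le.
- exact: cle_trans (O_con_le (proj1 mpsi)) le.
- exact: cle_trans (O_con_le (proj1 mchi)) lchi.
Qed.
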